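(* Let $X$ be a weakly Hausdorff space. For every lens $L$ in $X$, $\downarrow L$ is closed, and so $cl(L) = \downarrow L$. The orderings $\sqsubseteq^{\mathrm{TEM}}$ and $\sqsubseteq^{\mathrm{EM}}$ on the set of lenses of $X$ coincide.
   Context: Compact means every open cover has a finite subcover (no separation). The specialization preordering of $X$ is $x \leq y$ iff every open neighborhood of $x$ contains $y$; $\uparrow A$ and $\downarrow A$ denote upward and downward closures in $\leq$, with $\uparrow x = \uparrow\{x\}$; $cl(A)$ is the topological closure. A set is saturated iff it is upwards-closed in $\leq$. $X$ is weakly Hausdorff iff for all $x, y \in X$, every open set $W$ containing $\uparrow x \cap \uparrow y$ contains an intersection $U \cap V$ of an open neighborhood $U$ of $x$ and an open neighborhood $V$ of $y$. A lens of $X$ is a non-empty set of the form $Q \cap C$ with $Q$ compact saturated and $C$ closed. The topological Egli-Milner ordering on lenses is: $L \sqsubseteq^{\mathrm{TEM}} L'$ iff $\uparrow L \supseteq \uparrow L'$ and $cl(L) \subseteq cl(L')$. The Egli-Milner ordering is: $L \sqsubseteq^{\mathrm{EM}} L'$ iff $\uparrow L \supseteq \uparrow L'$ and $\downarrow L \subseteq \downarrow L'$. *)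

(* Defs.v *)
From mathcomp Require Import all_boot.
From mathcomp Require Import boolp classical_sets topology.

Set Implicit Arguments.
Unset Strict Implicit.
Unset Printing Implicit Defensive.

Local Open Scope classical_set_scope.

Section Lenses.
Variable X : topologicalType.
Implicit Types (x y : X) (A L Q C : set X).

Definition specialization x y := forall U : set X, open_nbhs x U -> U y.

Definition upset A : set X := [set y | exists2 x, A x & specialization x y].

Definition downset A : set X := [set x | exists2 y, A y & specialization x y].

Definition saturated A := forall x y, A x -> specialization x y -> A y.

Definition weakly_hausdorff :=
  forall x y (W : set X), open W -> upset [set x] `&` upset [set y] `<=` W ->
    exists U V : set X,
      [/\ open_nbhs x U, open_nbhs y V & U `&` V `<=` W].

(* [cover_compact] rather than [compact]: the latter is defined through cluster
   points, and the library relates the two ([compact_cover]) only on pointed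
   spaces, whereas X is arbitrary here. *)
Definition lens L :=
  L !=set0 /\
  exists Q C, [/\ cover_compact Q, saturated Q, closed C & L = Q `&` C].

Definition tem_le L L' :=
  upset L' `<=` upset L /\ closure L `<=` closure L'.

Definition em_le L L' :=
  upset L' `<=` upset L /\ downset L `<=` downset L'.

End Lenses.

Arguments weakly_hausdorff : clear implicits.

(* Main.v *)
Require Import Defs.
From mathcomp Require Import all_boot finmap.
From mathcomp Require Import boolp classical_sets topology.

(** If x is not below any point of Q `&` C, then upset [set x] `&` Q lies in the
    open set ~` C. Weak Hausdorffness applied to x and each y in Q, together with
    compactness of Q, yields an open neighborhood U of x with U `&` Q `<=` ~` C;
    so U misses the lens, hence also its downward closure, because open sets are
    upward closed. *)

Local Open Scope classical_set_scope.

Lemma weakly_hausdorff_compact_saturated (X : topologicalType) (x : X)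
    (Q W : set X) :
  weakly_hausdorff X -> cover_compact Q -> saturated Q -> open W ->
  upset [set x] `&` Q `<=` W -> exists2 U, open_nbhs x U & U `&` Q `<=` W.
Proof.
move=> HX cQ sQ oW xQW.
have /choice[UV UVP] (y : X) : exists UV : set X * set X, Q y ->
    [/\ open_nbhs x UV.1, open_nbhs y UV.2 & UV.1 `&` UV.2 `<=` W].
  (* Outside [Q] the pair is a dummy value, as [choice] needs a total function. *)
  have [Qy|nQy] := pselect (Q y); last by exists (set0, set0).
  have [|U [V UVW]] := HX x y W oW; last by exists (U, V).
  (* Saturation puts any point above both [x] and [y] in [Q], so [xQW] applies to it. *)
  by move=> z [xz [_ -> yz]]; apply: xQW; split=> //; exact: sQ yz.
have [D DQ QD] : finite_subset_cover Q (fun y => (UV y).2) Q.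
  apply: cQ => [y /UVP[_ []]//|y Qy].
  by exists y => //; have [_ []] := UVP y Qy.
(* Finiteness of [D] makes this intersection a neighborhood of [x]. *)
have : nbhs x (\bigcap_(y in [set` D]) (UV y).1).
  apply: filter_bigI => y /DQ/set_mem/UVP[xU _ _].
  exact: open_nbhs_nbhs.
rewrite nbhsE => -[U xU UD]; exists U => // z [Uz Qz].
have [y yD Vz] := QD z Qz.
have [_ _] := UVP y (set_mem (DQ y yD)); apply; split=> //.
exact: UD Uz y yD.
Qed.

Lemma closed_downset_lens (X : topologicalType) (L : set X) :
  weakly_hausdorff X -> lens L -> closed (downset L).
Proof.
move=> HX [_ [Q [C [cQ sQ clC ->]]]] x clx.
apply: contrapT => nx.
have [|U xU UQC] :=
    @weakly_hausdorff_compact_saturated X x Q (~` C) HX cQ sQ (closed_openC clC).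
  by move=> y [[_ -> xy] Qy] Cy; apply: nx; exists y.
have [z [[y [Qy Cy] zy] Uz]] := clx U (open_nbhs_nbhs xU).
by apply: (UQC y) => //; split=> //; apply: zy; split=> //; case: xU.
Qed.

Lemma subset_downset {X : topologicalType} (A : set X) : A `<=` downset A.
Proof. by move=> x Ax; exists x => // U []. Qed.

(** Every open neighborhood of a point below [y] contains [y], in any space. *)
Lemma downset_sub_closure {X : topologicalType} (A : set X) :
  downset A `<=` closure A.
Proof.
move=> x [y Ay xy] B; rewrite nbhsE => -[U xU UB].
by exists y; split=> //; apply: UB; exact: xy.
Qed.

Lemma closure_lens (X : topologicalType) (L : set X) :
  weakly_hausdorff X -> lens L -> closure L = downset L.
Proof.
move=> HX lL; apply/seteqP; split; last exact: downset_sub_closure.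
(* Being closed, [downset L] is its own closure, so monotonicity of closure suffices. *)
have /closure_id -> := closed_downset_lens _ _ HX lL.
exact/closureS/subset_downset.
Qed.

Theorem theorem6p4 (X : topologicalType) (HX : weakly_hausdorff X) :
  (forall L : set X, lens L -> closed (downset L) /\ closure L = downset L) /\
  (forall L L' : set X, lens L -> lens L' -> (tem_le L L' <-> em_le L L')).
Proof.
split=> [L lL|L L' lL lL'].
  by split; [exact: closed_downset_lens|exact: closure_lens].
(* With closures of lenses turned into downsets, the two orderings become the same formula. *)
by rewrite /tem_le /em_le !closure_lens.
Qed.
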